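(* Let $m\geq 2$ be an integer and let $1/(m+1)\leq\lambda<1/m$. Let $K_\lambda$ be the uniform $\lambda$-Cantor set (with $m$ maps), and let $K_R$, $\mathcal{A}$ and $\widehat{I}$ (for $I\in\mathcal{A}$) be as defined in the context. Then \[ K_{\lambda}\cdot K_{\lambda}= \left( \bigcup_{n=0}^{\infty}\lambda^{n}(K_{R}\cdot K_{R})\right) \cup\{0\}, \] where \[ K_{R}\cdot K_{R}=\left( \bigcup_{I\in\mathcal{A}}\widehat{I}\right)\cup\{x^{2}:x\in K_{R}\}. \]
   Context: For an integer $m\geq2$ and $0<\lambda<1/m$, put $g=\frac{1-m\lambda}{m-1}$ and $\delta=\lambda+g$. The uniform $\lambda$-Cantor set $K_\lambda\subset[0,1]$ is the attractor (unique nonempty compact set with $K_\lambda=\bigcup_{i=0}^{m-1}f_i(K_\lambda)$) of the iterated function system $f_i(x)=\lambda x+i\delta$, $0\leq i\leq m-1$. For a finite word $\sigma=i_1i_2\cdots i_n\in\{0,1,\dots,m-1\}^n$ of length $|\sigma|=n\geq 0$, put $f_\sigma=f_{i_1}\circ\cdots\circ f_{i_n}$; for the empty word, $f_\emptyset([0,1])=[0,1]$. For $I=f_\sigma([0,1])$ and $0\leq i\leq m-1$, let $I^{(i)}=f_{\sigma i}([0,1])$. For sets $X,Y\subset\mathbb{R}$, $X\cdot Y=\{xy:x\in X,\ y\in Y\}$, and for $c\in\mathbb{R}$, $cX=\{cx:x\in X\}$. For $I=f_\sigma([0,1])$ define \[ \widehat{I}=\begin{cases}\bigcup_{0\leq p<q\leq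 m-1} I^{(p)}\cdot I^{(q)} & \text{if } |\sigma|\geq1,\\[2pt] \bigcup_{1\leq p<q\leq m-1} I^{(p)}\cdot I^{(q)} & \text{if }\sigma=\emptyset.\end{cases} \] Let $\mathcal{A}=\{f_\sigma([0,1]):\sigma=i_1\cdots i_n,\ n\geq1,\ i_1\geq1\}\cup\{[0,1]\}$ and $K_R=\bigcup_{i=1}^{m-1}f_i(K_\lambda)$. *)

(* Defs.v *)
From mathcomp Require Import all_boot all_order all_algebra.
From mathcomp Require Import all_classical all_reals all_analysis.
Import Order.TTheory GRing.Theory Num.Theory.
Import numFieldNormedType.Exports.

Set Implicit Arguments.
Unset Strict Implicit.
Unset Printing Implicit Defensive.

Local Open Scope classical_set_scope.
Local Open Scope ring_scope.

Section UniformCantor.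
Context {R : realType}.
Implicit Types (X Y I K : set R).

Definition set_prod X Y : set R := [set x * y | x in X & y in Y].

Definition set_scale (c : R) X : set R := [set c * x | x in X].

Variables (m : nat) (lambda : R).

Definition gap : R := (1 - m%:R * lambda) / (m%:R - 1).

Definition delta : R := lambda + gap.

Definition ifs_map (i : 'I_m) (x : R) : R := lambda * x + i%:R * delta.

(* The attractor is the unique set with these three properties; its existence
   and uniqueness for 0 < lambda < 1/m is Hutchinson's theorem. *)
Definition is_uniform_cantor K : Prop :=
  [/\ K !=set0, compact K & K = \bigcup_(i : 'I_m) (ifs_map i @` K)].

Definition word_map (s : seq 'I_m) : R -> R :=
  foldr (fun i h => ifs_map i \o h) id s.

Definition cylinder (s : seq 'I_m) : set R := word_map s @` `[0, 1].

Definition word_hat (s : seq 'I_m) : set R :=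
  \bigcup_(pq in [set pq : 'I_m * 'I_m |
      (pq.1 < pq.2)%N /\ (s = [::] -> (1 <= pq.1)%N)])
    set_prod (cylinder (rcons s pq.1)) (cylinder (rcons s pq.2)).

(* For m >= 2 and 0 < lambda < 1/m distinct words have distinct cylinders, so
   the union below has exactly one term when I is a cylinder. *)
Definition hat I : set R := \bigcup_(s in [set s | cylinder s = I]) word_hat s.

Definition calA : set (set R) :=
  [set I | exists (i : 'I_m) (s : seq 'I_m),
      (1 <= i)%N /\ I = cylinder (i :: s)] `|` [set `[0, 1]%classic].

Definition right_part K : set R :=
  \bigcup_(i in [set i : 'I_m | (1 <= i)%N]) (ifs_map i @` K).

End UniformCantor.

(* Main.v *)
Require Import Defs.
From mathcomp Require Import all_boot all_order all_algebra.
From mathcomp Require Import all_classical all_reals all_analysis.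
From mathcomp Require Import ring lra.
Import Order.TTheory GRing.Theory Num.Theory.
Import numFieldNormedType.Exports.
Local Open Scope classical_set_scope.
Local Open Scope ring_scope.

(** Two points of [K_R] are equal, or they part after a longest common word, so
    [K_R . K_R] is contained in the right-hand side.  The converse says that
    [I . J = (K ∩ I) . (K ∩ J)] for two cylinders [I] to the left of [J] of the
    same level contained in [[delta, 1]].  Write [I = [a, a + t]] and
    [J = [b, b + t]].  Two numerical facts, [g <= lambda] and [g b <= delta],
    ensure that the products [I^(i) . J^(j)], listed lexicographically in
    [(i, j)], overlap consecutively and hence cover [I . J].  Iterating
    approximates every point of [I . J] by products of points of [K ∩ I] and
    [K ∩ J], and compactness concludes. *)

(** Induction on [N]: either [z] is at or above the last left end, hence in the last interval, or
    the overlap puts [z] below [U N] and the last interval is dropped. *)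
Lemma interval_chain {R : realDomainType} (L U : nat -> R) (N : nat) (z : R) :
  L 0 <= z -> z <= U N -> (forall k, (k < N)%N -> L k.+1 <= U k) ->
  exists k, [/\ (k <= N)%N, L k <= z & z <= U k].
Proof.
move=> L0z; elim: N => [|N IH] zU LU; first by exists 0.
have [LNz|zLN] := lerP (L N.+1) z; first by exists N.+1.
have zUN : z <= U N by apply: le_trans (ltW zLN) _; exact: LU.
have [k [kN Lz Uz]] := IH zUN (fun k kN => LU k (leqW kN)).
by exists k; split=> //; exact: leqW.
Qed.

(** Serves to turn estimates valid at every level of the construction into exact equalities. *)
Lemma le0_geometric {R : realType} (x C q : R) : 0 <= q -> q < 1 ->
  (forall n, x <= C * q ^+ n) -> x <= 0.
Proof.
move=> q0 q1 xC; have cvg0 : (fun n => C * q ^+ n) @ \oo --> (0 : R).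
  rewrite -(mulr0 C); apply: cvgM; first exact: cvg_cst.
  by apply: cvg_expr; rewrite ger0_norm.
rewrite -(cvg_lim (@Rhausdorff R) cvg0).
by apply: limr_ge; [apply/cvg_ex; exists 0 | near=> n].
Unshelve. all: by end_near. Qed.

Section ProductOfCantorSets.
Context {R : realType} (m : nat) (lambda : R) (K : set R).
Hypothesis hm : (2 <= m)%N.
Hypothesis lambda_ge : 1 / (m%:R + 1) <= lambda.
Hypothesis lambda_lt : lambda < 1 / m%:R.
Hypothesis hK : is_uniform_cantor m lambda K.
Local Notation delta := (delta m lambda).
Local Notation f := (@ifs_map R m lambda).
Local Notation KR := (right_part m lambda K).
Local Notation word_map := (@word_map R m lambda).
Local Notation cylinder := (@cylinder R m lambda).

(** * Arithmetic of [lambda] and [delta] *)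

Lemma natr_m_ge2 : (2 : R) <= m%:R. Proof. by rewrite ler_nat. Qed.

Lemma lambda_gt0 : 0 < lambda.
Proof. by apply: lt_le_trans lambda_ge; rewrite divr_gt0 // ltr_wpDl. Qed.

(** Geometrically, the map with the last digit [m - 1] fixes 1. *)
Lemma delta_total : (m%:R - 1) * delta + lambda = 1.
Proof.
rewrite /Defs.delta /gap; field.
by have := natr_m_ge2; apply: contraTneq => ?; lra.
Qed.

Lemma m_lambda_lt1 : m%:R * lambda < 1.
Proof.
by have := natr_m_ge2; move: lambda_lt => /[swap] ?; rewrite ltr_pdivlMr; lra.
Qed.

Lemma lambda_lt1 : lambda < 1.
Proof.
by have := lambda_gt0; have := m_lambda_lt1; have := natr_m_ge2; nra.
Qed.

Lemma lambda_lt_delta : lambda < delta.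
Proof.
by have := delta_total; have := m_lambda_lt1; have := natr_m_ge2; nra.
Qed.

(** This is the bound [g <= lambda]. Since [1 <= (m + 1) lambda], [delta_total] gives
    [(m - 1) delta <= m lambda], and [m <= 2 (m - 1)]. *)
Lemma delta_le_double : delta <= 2 * lambda.
Proof.
have : 1 <= lambda * (m%:R + 1)
  by move: lambda_ge; rewrite ler_pdivrMr // ltr_wpDl.
by have := delta_total; have := lambda_gt0; have := natr_m_ge2; nra.
Qed.

Lemma digit_delta_le (i : nat) : (i < m)%N -> i%:R * delta <= 1 - lambda.
Proof.
move=> im; have := delta_total; have := lambda_lt_delta; have := lambda_gt0.
have : i.+1%:R <= m%:R :> R by rewrite ler_nat.
by rewrite -natr1; nra.
Qed.

Lemma digit_delta_ge0 (i : nat) : 0 <= i%:R * delta.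
Proof.
by have := lambda_lt_delta; have := lambda_gt0; have := ler0n R i; nra.
Qed.

Lemma digit_delta_ge (i : nat) : (1 <= i)%N -> delta <= i%:R * delta.
Proof.
move=> i1; have : 1 <= i%:R :> R by rewrite ler1n.
by have := lambda_lt_delta; have := lambda_gt0; nra.
Qed.

(** * Points of the attractor and the first identity *)

Lemma cantor_map (i : 'I_m) x : K x -> K (f i x).
Proof. by case: hK => _ _ KE Kx; rewrite KE; exists i => //; exists x. Qed.

Lemma cantor_inv x : K x -> exists i : 'I_m, exists2 u, K u & x = f i u.
Proof.
by case: hK => _ _ {1}-> [i _ [u Ku <-]]; exists i, u.
Qed.

Lemma cantor_min : exists2 c, K c & forall x, K x -> c <= x.
Proof.
case: hK => K0 cK _.
have [|c] := @compact_EVT_min R R id K K0 cK.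
  by apply: continuous_subspaceT => x; exact: cvg_id.
by rewrite inE => Kc cle; exists c => // x Kx; apply: cle; rewrite inE.
Qed.

Lemma cantor_max : exists2 c, K c & forall x, K x -> x <= c.
Proof.
case: hK => K0 cK _.
have [|c] := @compact_EVT_max R R id K K0 cK.
  by apply: continuous_subspaceT => x; exact: cvg_id.
by rewrite inE => Kc cle; exists c => // x Kx; apply: cle; rewrite inE.
Qed.

(** Self-similarity is applied to the extreme points: the minimum satisfies [a >= lambda * a], the
    maximum [b <= lambda * b + (1 - lambda)]. *)
Lemma cantor_itv x : K x -> 0 <= x <= 1.
Proof.
move=> Kx.
have [a Ka amin] := cantor_min; have [b Kb bmax] := cantor_max.
have [i [u /amin au aE]] := cantor_inv _ Ka.
have [j [v /bmax bv bE]] := cantor_inv _ Kb.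
have := amin _ Kx; have := bmax _ Kx.
have := digit_delta_ge0 i; have := digit_delta_le _ (ltn_ord j).
have := lambda_gt0; have := lambda_lt1.
move: aE bE; rewrite /ifs_map => aE bE.
by move=> *; apply/andP; split; nra.
Qed.

Let digit0 : 'I_m := Ordinal (ltnW hm).

Lemma ifs_map0 x : f digit0 x = lambda * x.
Proof. by rewrite /ifs_map mul0r addr0. Qed.

Lemma cantor_scale n x : K x -> K (lambda ^+ n * x).
Proof.
move=> Kx; elim: n => [|n IH]; first by rewrite expr0 mul1r.
by rewrite exprS -mulrA -ifs_map0; exact: cantor_map.
Qed.

Lemma cantor0 : K 0.
Proof.
have [a Ka amin] := cantor_min.
have /andP[a0 _] := cantor_itv _ Ka.
have := amin _ (cantor_scale 1 _ Ka); have := lambda_lt1; rewrite expr1 => *.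
by have <- : a = 0 by nra.
Qed.

Lemma right_part_sub : KR `<=` K.
Proof. by move=> _ [i _ [u Ku <-]]; exact: cantor_map. Qed.

(** Leading zero digits are stripped until a nonzero one appears. If none ever does,
    [x <= lambda ^+ n] for all [n], which forces [x = 0]. *)
Lemma cantor_decomp x : K x -> x <> 0 ->
  exists n, exists2 y, KR y & x = lambda ^+ n * y.
Proof.
move=> Kx x0; apply: contrapT => noscale.
have tail n : exists2 u, K u & x = lambda ^+ n * u.
  elim: n => [|n [u Ku xE]]; first by exists x; rewrite // expr0 mul1r.
  have [i [v Kv uE]] := cantor_inv _ Ku.
  have [i0|i1] := posnP i.
    exists v => //; rewrite xE uE /ifs_map i0 mul0r addr0 exprSr mulrA //.
  by case: noscale; exists n, u => //; exists i => //; exists v.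
apply: x0; apply/eqP; rewrite eq_le; apply/andP; split; last first.
  by case/andP: (cantor_itv _ Kx).
apply: (@le0_geometric _ _ 1 _ (ltW lambda_gt0) lambda_lt1) => n.
have [u Ku ->] := tail n; rewrite mul1r ger_pMr ?exprn_gt0 ?lambda_gt0 //.
by case/andP: (cantor_itv _ Ku).
Qed.

Lemma cantor_prodE :
  set_prod K K =
    (\bigcup_(n : nat) set_scale (lambda ^+ n) (set_prod KR KR)) `|` [set 0].
Proof.
apply/seteqP; split=> [_ [x Kx [y Ky <-]]|z].
  have [->|/eqP x0] := eqVneq x 0; first by right; rewrite mul0r.
  have [->|/eqP y0] := eqVneq y 0; first by right; rewrite mulr0.
  have [p [u Ru ->]] := cantor_decomp _ Kx x0.
  have [q [v Rv ->]] := cantor_decomp _ Ky y0.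
  left; exists (p + q)%N => //; exists (u * v).
    by exists u => //; exists v.
  by rewrite exprD; ring.
case=> [[n _ [_ [u Ru [v Rv <-]] <-]]|->].
  exists (lambda ^+ n * u); first exact/cantor_scale/right_part_sub.
  by exists v; [exact: right_part_sub | rewrite mulrA].
by exists 0; [exact: cantor0 | exists 0; [exact: cantor0 | rewrite mulr0]].
Qed.

(** * Products of two cylinders of the same level *)

Lemma subproduct_cover a b t z : 0 < t -> delta <= a -> a + t <= b ->
  b + t <= 1 -> a * b <= z -> z <= (a + t) * (b + t) ->
  exists i j : 'I_m,
    (a + i%:R * delta * t) * (b + j%:R * delta * t) <= z /\
    z <= (a + i%:R * delta * t + lambda * t) *
         (b + j%:R * delta * t + lambda * t).
Proof.
move=> t0 da ab b1 zlo zhi.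
have l0 := lambda_gt0; have ld := lambda_lt_delta; have d2 := delta_le_double.
have dtot := delta_total.
have m0 : (0 < m)%N := ltnW hm.
have m1E : m.-1%:R = m%:R - 1 :> R by rewrite -subn1 natrB.
(* The last subintervals end exactly where [I] and [J] end, so both chains below reach their upper
   bound at index [m.-1]. *)
have lastE : m.-1%:R * delta * t + lambda * t = t.
  by rewrite -mulrDl m1E dtot mul1r.
pose A (i : nat) := a + i%:R * delta * t.
pose B (j : nat) := b + j%:R * delta * t.
(* First chain: the strips [I^(i) . J], which locate [i]. *)
have [|||i [im iz zi]] := @interval_chain _ (fun i => A i * b)
    (fun i => (A i + lambda * t) * (b + t)) m.-1 z.
- by rewrite /A !mul0r addr0.
- by rewrite /A -addrA lastE.
- move=> k _; rewrite /A -natr1.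
  set P := k%:R * delta * t.
  have P0 : 0 <= P by rewrite mulr_ge0 ?digit_delta_ge0 ?(ltW t0).
  (* Here [g b <= g <= lambda < delta <= a], using [b <= 1]. *)
  have gb : (delta - lambda) * b <= a by nra.
  rewrite -subr_ge0.
  have -> : (a + P + lambda * t) * (b + t) - (a + (k%:R + 1) * delta * t) * b
     = t * ((a - (delta - lambda) * b) + P + lambda * t) by rewrite /P; ring.
  by apply: mulr_ge0; nra.
have im' : (i < m)%N by rewrite -(prednK m0) ltnS.
have Ab : A i <= b.
  have := digit_delta_le _ im'; rewrite /A => idl.
  have : i%:R * delta * t <= (1 - lambda) * t by rewrite ler_pM2r.
  by nra.
(* Second chain: inside the strip of [i], the products [I^(i) . J^(j)] locate [j]. *)
have [|||j [jm jz zj]] := @interval_chain _ (fun j => A i * B j)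
    (fun j => (A i + lambda * t) * (B j + lambda * t)) m.-1 z.
- by rewrite /B !mul0r addr0.
- by rewrite /A /B -[b + _ + _]addrA lastE.
- move=> k _; rewrite /B -natr1.
  set P := k%:R * delta * t.
  have P0 : 0 <= P by rewrite mulr_ge0 ?digit_delta_ge0 ?(ltW t0).
  have A0 : 0 <= A i.
    rewrite /A addr_ge0 //; first by lra.
    by rewrite mulr_ge0 ?digit_delta_ge0 ?(ltW t0).
  rewrite -subr_ge0.
  (* Writing [A i * (lambda - delta)] as [A i * (2 * lambda - delta) - lambda * A i] leaves summands
     that are nonnegative by [g <= lambda] and by [Ab]. *)
  have -> : (A i + lambda * t) * (b + P + lambda * t) -
      A i * (b + (k%:R + 1) * delta * t)
     = t * (A i * (2 * lambda - delta) + lambda * (b + P - A i)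
            + lambda * (lambda * t)) by rewrite /P; ring.
  apply: mulr_ge0; first exact: ltW.
  by rewrite !addr_ge0 // mulr_ge0 //; nra.
have jm' : (j < m)%N by rewrite -(prednK m0) ltnS.
by exists (Ordinal im'), (Ordinal jm').
Qed.

(** Each step passes to subintervals given by [subproduct_cover]; they stay ordered inside
    [[delta, 1]] with [t] replaced by [lambda * t]. At level 0 the whole product has length
    [t * (a + b + t) <= 2 * t]. *)
Lemma product_approx n a b t z : 0 < t -> delta <= a -> a + t <= b ->
  b + t <= 1 -> a * b <= z -> z <= (a + t) * (b + t) ->
  exists u v, [/\ K u, K v &
    `|(a + t * u) * (b + t * v) - z| <= 2 * t * lambda ^+ n].
Proof.
have l0 := lambda_gt0; have ld := lambda_lt_delta.
elim: n a b t z => [|n IH] a b t z t0 da ab b1 zlo zhi.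
  exists 0, 0; split; [exact: cantor0..|].
  by rewrite !mulr0 !addr0 expr0 mulr1 ler_norml; apply/andP; split; nra.
have [i [j [lo hi]]] := subproduct_cover _ _ _ _ t0 da ab b1 zlo zhi.
have [iu iv] := (digit_delta_le _ (ltn_ord i), digit_delta_ge0 i).
have [ju jv] := (digit_delta_le _ (ltn_ord j), digit_delta_ge0 j).
have [||||u [v [Ku Kv uv]]] := IH _ _ (lambda * t) z _ _ _ _ lo hi.
- exact: mulr_gt0.
- by nra.
- by nra.
- by nra.
exists (f i u), (f j v); split; [exact: cantor_map..|].
by move: uv; rewrite /ifs_map exprS; congr (`| _ | <= _); ring.
Qed.

(** The distance to [z] attains its minimum on the compact set [K * K], and [product_approx] bounds
    this minimum by every [2 * t * lambda ^+ n]. *)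
Lemma product_attained a b t z : 0 < t -> delta <= a -> a + t <= b ->
  b + t <= 1 -> a * b <= z -> z <= (a + t) * (b + t) ->
  exists u v, [/\ K u, K v & (a + t * u) * (b + t * v) = z].
Proof.
move=> t0 da ab b1 zlo zhi.
pose dist (p : R * R) := `|(a + t * p.1) * (b + t * p.2) - z|.
have cdist : continuous dist.
  move=> p; apply: cvg_norm; apply: cvgB; last exact: cvg_cst.
  by apply: cvgM; apply: cvgD; (try exact: cvg_cst); apply: cvgM;
    (try exact: cvg_cst); [exact: cvg_fst | exact: cvg_snd].
have [_ cK _] := hK.
have [||[u v]] := @compact_EVT_min _ _ dist (K `*` K) _ (compact_setX cK cK).
- by exists (0, 0); split; exact: cantor0.
- exact: continuous_subspaceT.
rewrite inE => -[/= Ku Kv] distmin.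
exists u, v; split=> //; apply/eqP.
rewrite -subr_eq0 -normr_le0.
apply: (@le0_geometric _ _ (2 * t) _ (ltW lambda_gt0) lambda_lt1) => n.
have [u' [v' [Ku' Kv' le]]] := product_approx n _ _ _ _ t0 da ab b1 zlo zhi.
by apply: le_trans le; apply: (distmin (u', v')); rewrite inE.
Qed.

(** * Word maps and cylinders *)

Lemma word_mapE s x : word_map s x = word_map s 0 + lambda ^+ size s * x.
Proof.
elim: s x => [|i s IH] x /=; first by rewrite expr0 mul1r add0r.
by rewrite /ifs_map IH exprS; ring.
Qed.

Lemma word_map_rcons s i x : word_map (rcons s i) x = word_map s (f i x).
Proof. by elim: s => //= j s ->. Qed.

Lemma word_map_itv s x : 0 <= x <= 1 -> 0 <= word_map s x <= 1.
Proof.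
move=> x01; elim: s => //= i s /andP[]; rewrite /ifs_map.
have := digit_delta_le _ (ltn_ord i); have := digit_delta_ge0 i.
by have := lambda_gt0 => *; apply/andP; split; nra.
Qed.

Lemma cantor_word s x : K x -> K (word_map s x).
Proof. by move=> Kx; elim: s => //= i s; exact: cantor_map. Qed.

Lemma right_part_word (i : 'I_m) s x : (1 <= i)%N -> K x ->
  KR (word_map (i :: s) x).
Proof.
move=> i1 Kx; exists i => //; exists (word_map s x) => //.
exact: cantor_word.
Qed.

Lemma word_map_ge_delta (i : 'I_m) s x : (1 <= i)%N -> 0 <= x <= 1 ->
  delta <= word_map (i :: s) x.
Proof.
move=> i1 /(word_map_itv s)/andP[y0 _] /=; rewrite /ifs_map.
by have := digit_delta_ge _ i1; have := lambda_gt0; nra.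
Qed.

Lemma rcons_prod_sub (s : seq 'I_m) (p q : 'I_m) : (p < q)%N ->
  (s = [::] -> (1 <= p)%N) -> (if s is i :: _ then (1 <= i)%N else true) ->
  set_prod (cylinder (rcons s p)) (cylinder (rcons s q)) `<=` set_prod KR KR.
Proof.
move=> pq p1 s1 _ [_ [x x01 <-] [_ [y y01 <-] <-]].
move: x01 y01; rewrite /= !in_itv /= => /andP[x0 x1] /andP[y0 y1].
(* Both extended words begin with a nonzero digit. This puts the cylinders in [[delta, 1]] and the
   factors found in [K] into [KR]. *)
have headed (r : 'I_m) : (p <= r)%N ->
    exists i : 'I_m, exists2 s', (1 <= i)%N & rcons s r = i :: s'.
  case: s p1 s1 => [|i s'] p1 s1 pr; last by exists i, (rcons s' r).
  by exists r, [::] => //; exact: leq_trans (p1 erefl) pr.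
have [i [si i1 Ei]] := headed p (leqnn p).
have [j [sj j1 Ej]] := headed q (ltnW pq).
have t0 : 0 < lambda ^+ (size s).+1 by rewrite exprn_gt0 // lambda_gt0.
have apart : word_map (rcons s p) 0 + lambda ^+ (size s).+1
    <= word_map (rcons s q) 0.
  rewrite !word_map_rcons (word_mapE s (f p 0)) (word_mapE s (f q 0)).
  rewrite /ifs_map mulr0 !add0r exprSr -addrA lerD2l -mulrDr ler_pM2l; last first.
    by rewrite exprn_gt0 // lambda_gt0.
  have : p.+1%:R <= q%:R :> R by rewrite ler_nat.
  by rewrite -natr1; have := lambda_lt_delta; have := lambda_gt0; nra.
have top : word_map (rcons s q) 0 + lambda ^+ (size s).+1 <= 1.
  rewrite -[lambda ^+ _]mulr1 -(size_rcons s q) -word_mapE.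
  by have /andP[] := @word_map_itv (rcons s q) 1
    (introT andP (conj ler01 (lexx 1))).
have low : delta <= word_map (rcons s p) 0.
  by rewrite Ei; apply: word_map_ge_delta; rewrite // lexx ler01.
have := lambda_gt0; have := lambda_lt_delta => ld d0.
rewrite (word_mapE (rcons s p) x) (word_mapE (rcons s q) y) !size_rcons.
have [||u [v [Ku Kv <-]]] := product_attained _ _ _
    ((word_map (rcons s p) 0 + lambda ^+ (size s).+1 * x) *
     (word_map (rcons s q) 0 + lambda ^+ (size s).+1 * y)) t0 low apart top.
- by apply: ler_pM; nra.
- by apply: ler_pM; nra.
exists (word_map (rcons s p) u); first by rewrite Ei; exact: right_part_word.
exists (word_map (rcons s q) v); first by rewrite Ej; exact: right_part_word.
by rewrite (word_mapE (rcons s p)) (word_mapE (rcons s q)) !size_rcons.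
Qed.

(** * The second identity *)

Lemma calA_point I : calA m lambda I -> exists2 x, I x & delta <= x.
Proof.
case=> [[i [s [i1 ->]]]|->].
  exists (word_map (i :: s) 0).
    by exists 0 => //=; rewrite in_itv /= lexx ler01.
  by apply: word_map_ge_delta; rewrite // lexx ler01.
exists 1; first by rewrite /= in_itv /= lexx ler01.
have := delta_total; have := lambda_gt0; have := lambda_lt_delta.
by have := natr_m_ge2; nra.
Qed.

(** [hat] ranges over every word that names the given cylinder, so the leading digit must be read
    off the set itself: a leading 0 would confine it to [[0, lambda]], away from the point of
    [calA_point]. *)
Lemma calA_head s : calA m lambda (cylinder s) ->
  if s is i :: _ then (1 <= i)%N else true.
Proof.
case: s => // i s /calA_point[_ [x x01 <-] /=].
move: x01; rewrite /= in_itv /= => /(word_map_itv s)/andP[_ y1].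
rewrite /ifs_map lt0n; apply: contraTneq => ->.
by rewrite mul0r addr0 -ltNge; have := lambda_lt_delta; have := lambda_gt0; nra.
Qed.

(** If the digits could always be chosen equal, [u] and [v] would share words of every length [n],
    so [u - v] would be at most [lambda ^+ n] in absolute value. *)
Lemma ifs_branch u v : K u -> K v -> u <> v ->
  exists s : seq 'I_m, exists p q : 'I_m, p <> q /\
    exists x y, [/\ K x, K y, u = word_map (rcons s p) x &
      v = word_map (rcons s q) y].
Proof.
move=> Ku Kv uv; apply: contrapT => nobranch; apply: uv.
suff near n : exists s : seq 'I_m, exists x y, [/\ K x, K y, size s = n,
    u = word_map s x & v = word_map s y].
  apply/eqP; rewrite -subr_eq0 -normr_le0.
  apply: (@le0_geometric _ _ 1 _ (ltW lambda_gt0) lambda_lt1) => n.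
  have [s [x [y [Kx Ky sn -> ->]]]] := near n.
  rewrite (word_mapE s x) (word_mapE s y) opprD addrACA subrr add0r.
  rewrite -mulrBr normrM sn.
  rewrite ger0_norm ?exprn_ge0 ?(ltW lambda_gt0) // mul1r.
  rewrite ler_piMr ?exprn_ge0 ?(ltW lambda_gt0) // ler_norml.
  have := cantor_itv _ Kx; have := cantor_itv _ Ky.
  by move=> /andP[? ?] /andP[? ?]; apply/andP; split; lra.
elim: n => [|n [s [x [y [Kx Ky sn uE vE]]]]]; first by exists [::], u, v.
have [p [x' Kx' xE]] := cantor_inv _ Kx.
have [q [y' Ky' yE]] := cantor_inv _ Ky.
have [pq|/eqP pq] := eqVneq p q; last first.
  case: nobranch; exists s, p, q; split=> //.
  by exists x', y'; rewrite !word_map_rcons -xE -yE.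
exists (rcons s p), x', y'; rewrite size_rcons sn !word_map_rcons -xE.
by split=> //; rewrite pq -yE.
Qed.

Lemma cylinder_word s x : K x -> cylinder s (word_map s x).
Proof. by move=> /cantor_itv x01; exists x => //=; rewrite in_itv. Qed.

Lemma right_part_prod_lt s (p q : 'I_m) x y : p <> q ->
  (s = [::] -> (1 <= p)%N /\ (1 <= q)%N) -> K x -> K y ->
  word_hat lambda s (word_map (rcons s p) x * word_map (rcons s q) y).
Proof.
wlog pq : p q x y / (p < q)%N => [th|].
  move=> pq s1 Kx Ky; case: (ltngtP p q) => [| |/val_inj //] lt.
    exact: th.
  rewrite mulrC; apply: th => //; first exact/nesym.
  by move=> /s1[].
move=> _ s1 Kx Ky; exists (p, q); first by split=> // /s1[].
exists (word_map (rcons s p) x); first exact: cylinder_word.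
by exists (word_map (rcons s q) y); first exact: cylinder_word.
Qed.

Lemma right_part_prodE :
  set_prod KR KR =
    (\bigcup_(I in calA m lambda) hat m lambda I) `|` [set x ^+ 2 | x in KR].
Proof.
apply/seteqP; split=> [_ [u Ru [v Rv <-]]|z].
  have [<-|/eqP uv] := eqVneq u v; first by right; exists u; rewrite // expr2.
  left; case: Ru uv => i i1 [u' Ku' <-]; case: Rv => j j1 [v' Kv' <-] uv.
  have [ij|/eqP ij] := eqVneq i j; last first.
    (* Distinct first digits, both nonzero, are covered by the empty word; this is why its [hat]
       requires [1 <= p]. *)
    exists `[0, 1]%classic; first by right.
    exists [::]; first by rewrite /= /Defs.cylinder image_id.
    exact: (right_part_prod_lt [::]).
  move: uv; rewrite -ij => uv.
  have uv' : u' <> v' by move=> uvE; apply: uv; rewrite uvE.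
  have [s [p [q [pq [x [y [Kx Ky -> ->]]]]]]] := ifs_branch _ _ Ku' Kv' uv'.
  exists (cylinder (i :: s)); first by left; exists i, s.
  by exists (i :: s) => //; exact: (right_part_prod_lt (i :: s)).
case=> [[I AI [s sI [[p q] [/= pq s1] zpq]]]|[x Rx <-]].
  apply: rcons_prod_sub zpq => //; apply: calA_head.
  by rewrite sI.
by exists x => //; exists x; rewrite // expr2.
Qed.

End ProductOfCantorSets.

Theorem theorem1 (R : realType) (m : nat) (lambda : R) (K : set R)
  (hm : (2 <= m)%N)
  (hlambda_ge : 1 / (m%:R + 1) <= lambda) (hlambda_lt : lambda < 1 / m%:R)
  (hK : is_uniform_cantor m lambda K) :
  let KR := right_part m lambda K in
  set_prod K K =
    (\bigcup_(n : nat) set_scale (lambda ^+ n) (set_prod KR KR)) `|` [set 0]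
  /\
  set_prod KR KR =
    (\bigcup_(I in calA m lambda) hat m lambda I) `|` [set x ^+ 2 | x in KR].
Proof. by split; [exact: cantor_prodE | exact: right_part_prodE]. Qed.
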